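(* Let $a_1,a_2,a_3>0$ be real numbers, $\Delta=\sqrt{a_1a_2a_3}$, $\Omega=\mathrm{diag}(a_1,a_2,a_3)$, let $\mathbf u=(u_1,u_2,u_3)\in\mathbb R^3_{a_1,a_2,a_3}$ be a unit vector, i.e. $a_1u_1^2+a_2u_2^2+a_3u_3^2=1$, and let $$T=\Delta\begin{bmatrix}0&-u_3/a_1&u_2/a_1\\ u_3/a_2&0&-u_1/a_2\\ -u_2/a_3&u_1/a_3&0\end{bmatrix}.$$ Then for every $\theta\in\mathbb R$ the matrix exponential satisfies $$R_\theta^{\mathcal B,\mathbf u}:=e^{T\theta}=I+(\sin\theta)\,T+(1-\cos\theta)\,T^2,$$ and it gives an elliptical rotation on the ellipsoid $a_1x^2+a_2y^2+a_3z^2=1$ (that is, it is an elliptical rotation matrix in $\mathbb R^3_{a_1,a_2,a_3}$). Furthermore, $R_\theta^{\mathcal B,\mathbf u}$ equals $$\begin{bmatrix} a_1u_1^2+(1-a_1u_1^2)\cos\theta & -\tfrac{\Delta u_3\sin\theta}{a_1}-a_2u_1u_2(\cos\theta-1) & \tfrac{\Delta u_2\sin\theta}{a_1}-a_3u_1u_3(\cos\theta-1)\\ \tfrac{\Delta u_3\sin\theta}{a_2}-a_1u_1u_2(\cos\theta-1) & a_2u_2^2+(1-a_2u_2^2)\cos\theta & -\tfrac{\Delta u_1\sin\theta}{a_2}-a_3u_2u_3(\cos\theta-1)\\ -\tfrac{\Delta u_2\sin\theta}{a_3}-a_1u_1u_3(\cos\theta-1) & \tfrac{\Delta u_1\sin\theta}{a_3}-a_2u_2u_3(\cos\theta-1)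 & a_3u_3^2+(1-a_3u_3^2)\cos\theta \end{bmatrix},$$ where $\mathbf u$ is the rotation axis and $\theta$ is the elliptical rotation angle.
   Context: $\mathbb R^3_{a_1,a_2,a_3}$ denotes $\mathbb R^3$ with the elliptical inner product $\mathcal B(\mathbf u,\mathbf w)=a_1u_1w_1+a_2u_2w_2+a_3u_3w_3=\mathbf u^t\Omega\mathbf w$ and norm $\|\mathbf u\|_{\mathcal B}=\sqrt{\mathcal B(\mathbf u,\mathbf u)}$. The elliptical vector product is $$\mathcal V(\mathbf u\times\mathbf v)=\Delta\left(\tfrac{u_2v_3-u_3v_2}{a_1},\ \tfrac{u_3v_1-u_1v_3}{a_2},\ \tfrac{u_1v_2-u_2v_1}{a_3}\right),$$ so that $T\mathbf v=\mathcal V(\mathbf u\times\mathbf v)$ for the matrix $T$ in the claim. A matrix $R\in\mathbb R^{3\times3}$ is an elliptical rotation matrix if $R^t\Omega R=\Omega$ and $\det R=1$ (such a matrix maps the ellipsoid $a_1x^2+a_2y^2+a_3z^2=1$ to itself). That the $\mathcal B$-unit vector $\mathbf u$ is the rotation axis and $\theta$ the elliptical rotation angle of $R$ means: $R\mathbf u=\mathbf u$, and $R\mathbf v=\cos\theta\,\mathbf v+\sin\theta\,\mathcal V(\mathbf u\times\mathbf v)$ for every $\mathbf v$ with $\mathcal B(\mathbf u,\mathbf v)=0$. *)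

(* Defs.v *)
From HB Require Import structures.
From mathcomp Require Import all_boot all_order all_algebra.
From mathcomp Require Import all_classical all_reals all_analysis.

Set Implicit Arguments.
Unset Strict Implicit.
Unset Printing Implicit Defensive.

Import Order.TTheory GRing.Theory Num.Theory.
Import numFieldNormedType.Exports.

Local Open Scope classical_set_scope.
Local Open Scope ring_scope.

Section MatrixExponential.
Context {R : realType} {n : nat}.
Implicit Types A : 'M[R]_n.+1.

Definition mxexp_coeff A : nat -> 'M[R]_n.+1 := fun k => (k`!%:R)^-1 *: A ^+ k.

Definition mxexp A : 'M[R]_n.+1 := limn (series (mxexp_coeff A)).

Lemma mx_norm_mul A B : `|A * B| <= n.+1%:R * `|A| * `|B|.
Proof.
have le_entry (C : 'M[R]_n.+1) i j : `|C i j| <= `|C|.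
  by rewrite [leRHS]/Num.norm/= mx_normrE; apply: (le_bigmax _ _ (i, j)).
rewrite [leLHS]/Num.norm/= mx_normrE; apply: bigmax_le => [|[i j] _ /=].
  by rewrite !mulr_ge0.
rewrite mxE (le_trans (ler_norm_sum _ _ _))//.
apply: (@le_trans _ _ (\sum_(k < n.+1) `|A| * `|B|)).
  by apply: ler_sum => k _; rewrite normrM ler_pM.
by rewrite sumr_const card_ord -mulrA mulr_natl.
Qed.

Lemma mx_norm_exp A k : `|A ^+ k| <= (n.+1%:R * `|A|) ^+ k * `|1 : 'M[R]_n.+1|.
Proof.
elim: k => [|k IHk]; first by rewrite !expr0 mul1r.
rewrite !exprS (le_trans (mx_norm_mul _ _))// -[leRHS]mulrA.
by rewrite ler_wpM2l// mulr_ge0.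
Qed.

(* [lim] is total; this shows that [mxexp] never takes its default value. *)
Lemma is_cvg_series_mxexp_coeff A : cvgn (series (mxexp_coeff A)).
Proof.
pose x := n.+1%:R * `|A|.
have cx : cvgn (series (`|1 : 'M[R]_n.+1| *: exp_coeff x)).
  by apply: is_cvg_seriesZ; exact: is_cvg_series_exp_coeff.
have cA : cvgn [normed series (mxexp_coeff A)]; last first.
  move/cauchy_cvgP/cauchy_seriesP in cA.
  apply/cauchy_cvgP/cauchy_seriesP => e /cA.
  apply: filterS => k /=; rewrite ger0_norm ?sumr_ge0//.
  by apply: le_lt_trans; exact: ler_norm_sum.
apply: series_le_cvg cx => k; first exact: normr_ge0.
  by rewrite /= mulr_ge0// exp_coeff_ge0// mulr_ge0.
rewrite /= /mxexp_coeff normrZ ger0_norm ?invr_ge0//.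
rewrite [leRHS]mulrC /exp_coeff/= mulrC.
rewrite mulrAC ler_wpM2r ?invr_ge0//.
exact: mx_norm_exp.
Qed.

End MatrixExponential.

(* Coordinates u_1, u_2, u_3 are the entries of index 0, 1, 2. *)
Section EllipticalSpace.
Context {R : realType}.

Definition mx3 (rows : seq (seq R)) : 'M[R]_3 :=
  \matrix_(i < 3, j < 3) nth 0 (nth [::] rows i) j.

Definition cv3 (x y z : R) : 'cV[R]_3 := \col_(i < 3) nth 0 [:: x; y; z] i.

Variables a1 a2 a3 : R.
Implicit Types (u v w : 'cV[R]_3) (M : 'M[R]_3).

Definition ell_Delta : R := Num.sqrt (a1 * a2 * a3).

Definition ell_Omega : 'M[R]_3 :=
  mx3 [:: [:: a1; 0; 0]; [:: 0; a2; 0]; [:: 0; 0; a3]].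

Definition ell_inner u w : R :=
  a1 * u 0 0 * w 0 0 + a2 * u 1 0 * w 1 0 + a3 * u 2 0 * w 2 0.

Definition ell_cross u v : 'cV[R]_3 :=
  ell_Delta *: cv3 ((u 1 0 * v 2 0 - u 2 0 * v 1 0) / a1)
                   ((u 2 0 * v 0 0 - u 0 0 * v 2 0) / a2)
                   ((u 0 0 * v 1 0 - u 1 0 * v 0 0) / a3).

Definition ell_rotation_mx M : Prop :=
  M^T *m ell_Omega *m M = ell_Omega /\ \det M = 1.

(* [M] is the elliptical rotation about the axis [u] by the angle [theta]; meant
   for [u] with [ell_inner u u = 1]. *)
Definition ell_axis_angle M u (theta : R) : Prop :=
  M *m u = u /\
  forall v, ell_inner u v = 0 ->
    M *m v = cos theta *: v + sin theta *: ell_cross u v.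

End EllipticalSpace.

(* Main.v *)
(* The generator T satisfies T u = 0 and T^2 = u u^t Omega - I, hence T^3 = - T,
   so the powers of T alternate between multiples of T and of T^2 and the
   exponential series splits into the sine and cosine series.  As
   T^t Omega = - Omega T, the identity R_x^t Omega = Omega R_(-x) combines with
   R_x R_y = R_(x + y) to give R_x^t Omega R_x = Omega; the determinant is 1, and
   not -1, because R_x is the square of R_(x/2). *)
Require Import Defs.
From HB Require Import structures.
From mathcomp Require Import all_boot all_order all_algebra.
From mathcomp Require Import all_classical all_reals all_analysis.
From mathcomp Require Import ring.

Set Implicit Arguments.
Unset Strict Implicit.
Unset Printing Implicit Defensive.

Import Order.TTheory GRing.Theory Num.Theory.
Import numFieldNormedType.Exports.

Local Open Scope classical_set_scope.
Local Open Scope ring_scope.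

Section SkewCubic.
Context {R : realType} {n : nat} (A : 'M[R]_n.+1).
Hypothesis A3 : A ^+ 3 = - A.

Lemma expr_skew_cubic_odd k : A ^+ k.*2.+1 = (-1) ^+ k *: A.
Proof.
elim: k => [|k IHk]; first by rewrite expr0 scale1r.
rewrite doubleS -[k.*2.+3]addn2 exprD IHk -scalerAl -exprS A3.
by rewrite scalerN exprS mulN1r scaleNr.
Qed.

Lemma expr_skew_cubic_even k : A ^+ k.*2.+2 = (-1) ^+ k *: A ^+ 2.
Proof. by rewrite exprS expr_skew_cubic_odd -scalerAr. Qed.

(** The constant term of the cosine series cancels the 1 in front of it, so [A ^+ 2] enters only
    from degree 2 on. The index is [k.+1] because the empty partial sum is 0, while the right-hand
    side would be [1 + A ^+ 2]. *)
Lemma series_mxexp_coeff_skew_cubic (x : R) k :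
  series (mxexp_coeff (x *: A)) k.+1 =
  1 + series (sin_coeff x) k.+1 *: A + (1 - series (cos_coeff x) k.+1) *: A ^+ 2.
Proof.
elim: k => [|k IHk].
  rewrite /series/= !big_nat1 (sin_coeff_even 0) [cos_coeff _ _]divr1 /=.
  by rewrite /mxexp_coeff !expr0 !mul1r subrr !scale0r !addr0 invr1 scale1r.
rewrite !(@seriesSr _ _ k.+1) IHk.
suff -> : mxexp_coeff (x *: A) k.+1 =
    sin_coeff x k.+1 *: A - cos_coeff x k.+1 *: A ^+ 2.
  by rewrite addrACA -scaleNr -!scalerDl (scalerDl A) opprD !addrA.
(* The parity of [k] decides which coefficient vanishes. The even power carries [(-1) ^+ m] against
   [(-1) ^+ m.+1] in the cosine series, whence the minus sign. *)
rewrite /mxexp_coeff exprZn scalerA -(odd_double_half k).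
move: k./2 => m; case: (odd k).
  rewrite add1n expr_skew_cubic_even scalerA (sin_coeff_even m.+1).
  rewrite scale0r sub0r -scaleNr /cos_coeff/= odd_double/= doubleK.
  by congr (_ *: _); rewrite -exprnP (exprS (-1)); ring.
rewrite add0n expr_skew_cubic_odd scalerA cos_coeff_odd scale0r subr0.
rewrite /sin_coeff/= odd_double/= doubleK.
by congr (_ *: _); ring.
Qed.

Definition rodrigues (x : R) : 'M[R]_n.+1 :=
  1 + sin x *: A + (1 - cos x) *: A ^+ 2.

Lemma mxexp_skew_cubic (x : R) : mxexp (x *: A) = rodrigues x.
Proof.
(* The shift discards the empty partial sum, where the closed form fails. *)
apply: cvg_lim => //; rewrite -cvg_shiftS.
under eq_fun do rewrite series_mxexp_coeff_skew_cubic.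
apply: cvgD; first apply: cvgD; first exact: cvg_cst.
  (* Unlocking exposes [sin] as the limit of its series, so convergence of that series is all that
     remains. *)
  apply: cvgZr_tmp; rewrite (cvg_shiftS (series (sin_coeff x))) unlock.
  exact: is_cvg_series_sin_coeff.
apply: cvgZr_tmp; apply: cvgB; first exact: cvg_cst.
rewrite (cvg_shiftS (series (cos_coeff x))) unlock.
exact: is_cvg_series_cos_coeff.
Qed.

Lemma rodrigues0 : rodrigues 0 = 1.
Proof. by rewrite /rodrigues sin0 cos0 subrr !scale0r !addr0. Qed.

Lemma rodriguesD (x y : R) : rodrigues (x + y) = rodrigues x * rodrigues y.
Proof.
(* This product is the derivative of [rodrigues] at [x]; the cubic relation brings it back to the
   span of [A] and [A ^+ 2]. *)
have rA : rodrigues x * A = cos x *: A + sin x *: A ^+ 2.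
  rewrite !mulrDl mul1r -!scalerAl -exprSr A3 -expr2.
  by rewrite scalerN scalerBl scale1r opprB addrC addrA addrNK addrC.
rewrite {2}/rodrigues !mulrDr mulr1 -!scalerAr expr2 mulrA rA mulrDl -!scalerAl.
rewrite -expr2 -exprSr A3 /rodrigues sinD cosD; move: (A ^+ 2) => B.
by apply/matrixP => i j; rewrite !mxE; ring.
Qed.

End SkewCubic.

Lemma rodriguesM (R : realType) n (A : 'M[R]_n.+1) (x : R) (v : 'cV[R]_n.+1) :
  rodrigues A x *m v =
  v + sin x *: (A *m v) + (1 - cos x) *: (A *m (A *m v)).
Proof. by rewrite !mulmxDl mul1mx -!scalemxAl expr2 mulmxA. Qed.

(** Moving [A] across the form [O] changes its sign and leaves that of [A ^+ 2], which matches sine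
    being odd and cosine even. *)
Lemma tr_rodriguesM (R : realType) n (A O : 'M[R]_n.+1) (x : R) :
  A^T *m O = - (O *m A) -> (rodrigues A x)^T *m O = O *m rodrigues A (- x).
Proof.
move=> trA.
have trA2 : (A ^+ 2)^T *m O = O *m A ^+ 2.
  by rewrite !expr2 trmx_mul -mulmxA trA mulmxN mulmxA trA mulNmx opprK -mulmxA.
rewrite /rodrigues sinN cosN !linearD !linearZ /= trmx1.
rewrite !mulmxDl -!scalemxAl trA2 trA.
by rewrite mul1mx mulmx1 scalerN scaleNr.
Qed.

Section Coordinates.
Context {R : realType}.

Lemma ord3P (P : 'I_3 -> Prop) : P 0 -> P 1 -> P 2 -> forall i, P i.
Proof.
move=> P0 P1 P2 [[|[|[|//]]] lti].
- by rewrite (_ : Ordinal _ = 0)//; apply/val_inj.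
- by rewrite (_ : Ordinal _ = 1)//; apply/val_inj.
- by rewrite (_ : Ordinal _ = 2)//; apply/val_inj.
Qed.

Lemma sum3E (V : nmodType) (F : 'I_3 -> V) : \sum_i F i = F 0 + F 1 + F 2.
Proof.
rewrite !big_ord_recr big_ord0 /= add0r.
by congr (F _ + F _ + F _); apply/val_inj.
Qed.

Lemma cV3P (v w : 'cV[R]_3) :
  v 0 0 = w 0 0 -> v 1 0 = w 1 0 -> v 2 0 = w 2 0 -> v = w.
Proof. by move=> *; apply/colP; elim/ord3P. Qed.

End Coordinates.

Section EllipticalGenerator.
Context {R : realType}.
Variables (a1 a2 a3 : R) (u : 'cV[R]_3).
Hypotheses (ha1 : 0 < a1) (ha2 : 0 < a2) (ha3 : 0 < a3).
Hypothesis hu : ell_inner a1 a2 a3 u u = 1.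

Local Notation Delta := (ell_Delta a1 a2 a3).
Local Notation Omega := (ell_Omega a1 a2 a3).
Local Notation inner := (ell_inner a1 a2 a3).

Definition ell_skew : 'M[R]_3 :=
  Delta *: mx3 [:: [:: 0; - (u 2 0 / a1); u 1 0 / a1];
                   [:: u 2 0 / a2; 0; - (u 0 0 / a2)];
                   [:: - (u 1 0 / a3); u 0 0 / a3; 0]].

Let Delta2 : Delta ^+ 2 = a1 * a2 * a3.
Proof. by rewrite sqr_sqrtr// !mulr_ge0// ltW. Qed.

Let a_neq0 : [/\ a1 != 0, a2 != 0 & a3 != 0].
Proof. by rewrite !gt_eqF. Qed.

Lemma ell_skewM v : ell_skew *m v = ell_cross a1 a2 a3 u v.
Proof. by apply: cV3P; rewrite !mxE sum3E !mxE/=; ring. Qed.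

Lemma ell_skewM_axis : ell_skew *m u = 0.
Proof. by rewrite ell_skewM; apply: cV3P; rewrite !mxE/=; ring. Qed.

Lemma ell_innerE v w : v^T *m Omega *m w = (inner v w)%:M.
Proof.
apply/matrixP => i j; rewrite !ord1 mxE sum3E !mxE !sum3E !mxE/= /ell_inner.
by ring.
Qed.

(** Matrix form of the triple product rule: applying $u \times$ twice to $v$ gives $B(u,v)u -
    B(u,u)v$, with $B(u,u) = 1$. *)
Lemma ell_skew_sqrE : ell_skew ^+ 2 = u *m (u^T *m Omega) - 1.
Proof.
have [a10 a20 a30] := a_neq0.
have DD x y : Delta * x * (Delta * y) = a1 * a2 * a3 * (x * y).
  by rewrite mulrACA -expr2 Delta2.
(* Reading [hu] backwards turns the 1 of the identity matrix into $B(u,u)$; the entries then agree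
   identically as rational expressions. *)
apply/matrixP; elim/ord3P; elim/ord3P; rewrite expr2 !mxE big_ord1 !mxE !sum3E;
  rewrite !mxE/= !DD -?hu /ell_inner; field; by rewrite ?a10 ?a20 ?a30.
Qed.

Lemma ell_skew_cubic : ell_skew ^+ 3 = - ell_skew.
Proof.
rewrite exprS ell_skew_sqrE mulrBr mulr1.
by rewrite [_ * (_ *m _)]mulmxA ell_skewM_axis mul0mx sub0r.
Qed.

(** Multiplying by [Omega] clears the denominators: [Omega *m ell_skew] is [Delta] times the
    Euclidean cross product matrix of [u], which is antisymmetric. *)
Lemma tr_ell_skewM : ell_skew^T *m Omega = - (Omega *m ell_skew).
Proof.
have [a10 a20 a30] := a_neq0.
by apply/matrixP; elim/ord3P; elim/ord3P; rewrite !mxE !sum3E !mxE/=; field;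
  by rewrite ?a10 ?a20 ?a30.
Qed.

Lemma ell_rotation_rodrigues x : ell_rotation_mx a1 a2 a3 (rodrigues ell_skew x).
Proof.
have orth y :
    (rodrigues ell_skew y)^T *m Omega *m rodrigues ell_skew y = Omega.
  rewrite (tr_rodriguesM _ tr_ell_skewM) -mulmxA -[_ *m rodrigues _ _]/(_ * _).
  by rewrite -(rodriguesD ell_skew_cubic) addNr rodrigues0 mulmx1.
split=> //.
rewrite -(divrK (x := 2) _ x) ?unitfE// mulr_natr mulr2n.
rewrite (rodriguesD ell_skew_cubic) det_mulmx.
have detO : \det Omega != 0.
  have -> : Omega = diag_mx (\row_i [:: a1; a2; a3]`_i).
    by apply/matrixP; elim/ord3P; elim/ord3P; rewrite !mxE.
  rewrite det_diag !big_ord_recr big_ord0 !mxE /= mul1r.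
  by have [a10 a20 a30] := a_neq0; rewrite !mulf_neq0.
(* At the half angle, orthogonality says that the squared determinant times [\det Omega] is
   [\det Omega], which cancels. *)
move/(congr1 determinant): (orth (x / 2)); rewrite !det_mulmx det_tr mulrAC.
by rewrite -[RHS]mul1r => /mulIf; apply.
Qed.

Lemma ell_axis_angle_rodrigues x :
  ell_axis_angle a1 a2 a3 (rodrigues ell_skew x) u x.
Proof.
split=> [|v uv0]; rewrite rodriguesM.
  by rewrite ell_skewM_axis mulmx0 !scaler0 !addr0.
(* On the [inner]-orthogonal complement of [u] the squared generator acts as -1. *)
rewrite [ell_skew *m (_ *m _)]mulmxA -[ell_skew *m ell_skew]expr2.
rewrite ell_skew_sqrE mulmxBl mul1mx -mulmxA ell_innerE uv0.
rewrite mul_mx_scalar scale0r sub0r scalerN scalerBl scale1r opprB.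
by rewrite addrAC addrCA subrr addr0 ell_skewM.
Qed.

End EllipticalGenerator.

Theorem theorem2 (R : realType) (a1 a2 a3 : R) (u : 'cV[R]_3)
    (ha1 : 0 < a1) (ha2 : 0 < a2) (ha3 : 0 < a3)
    (hu : a1 * u 0 0 ^+ 2 + a2 * u 1 0 ^+ 2 + a3 * u 2 0 ^+ 2 = 1) :
  let u1 := u 0 0 in
  let u2 := u 1 0 in
  let u3 := u 2 0 in
  let Delta := ell_Delta a1 a2 a3 in
  let T := Delta *: mx3 [:: [:: 0; - (u3 / a1); u2 / a1];
                            [:: u3 / a2; 0; - (u1 / a2)];
                            [:: - (u2 / a3); u1 / a3; 0]] in
  forall theta : R,
  let Rtheta := mxexp (theta *: T) in
  let c := cos theta in
  let s := sin theta in
  [/\ Rtheta = 1%:M + s *: T + (1 - c) *: T ^+ 2,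
      ell_rotation_mx a1 a2 a3 Rtheta,
      Rtheta = mx3
        [:: [:: a1 * u1 ^+ 2 + (1 - a1 * u1 ^+ 2) * c;
                - (Delta * u3 * s / a1) - a2 * u1 * u2 * (c - 1);
                Delta * u2 * s / a1 - a3 * u1 * u3 * (c - 1)];
            [:: Delta * u3 * s / a2 - a1 * u1 * u2 * (c - 1);
                a2 * u2 ^+ 2 + (1 - a2 * u2 ^+ 2) * c;
                - (Delta * u1 * s / a2) - a3 * u2 * u3 * (c - 1)];
            [:: - (Delta * u2 * s / a3) - a1 * u1 * u3 * (c - 1);
                Delta * u1 * s / a3 - a2 * u2 * u3 * (c - 1);
                a3 * u3 ^+ 2 + (1 - a3 * u3 ^+ 2) * c]]
    & ell_axis_angle a1 a2 a3 Rtheta u theta].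

move=> u1 u2 u3 Delta T theta Rtheta c s.
have hu' : ell_inner a1 a2 a3 u u = 1.
  by rewrite /ell_inner -hu; ring.
have T3 : T ^+ 3 = - T by exact: ell_skew_cubic.
have RE : Rtheta = rodrigues T theta by exact: mxexp_skew_cubic.
split; rewrite RE //.
- exact: ell_rotation_rodrigues.
(* With the square of [T] replaced, [Delta] occurs only linearly and no denominator has to cancel,
   so [ring] suffices. *)
- rewrite /rodrigues (ell_skew_sqrE ha1 ha2 ha3 hu').
  apply/matrixP; elim/ord3P; elim/ord3P; rewrite !mxE big_ord1 !mxE !sum3E;
  rewrite !mxE/=; rewrite -/Delta -/u1 -/u2 -/u3 -/c -/s; ring.
- exact: ell_axis_angle_rodrigues.
Qed.
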